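(* Let $n,m\ge 1$ be integers with $n\ne m$, and consider a node $J$ with $n$ incoming arcs and $m$ outgoing arcs, with flux $f$. Then no Riemann solver $\mathcal{RS}$ at $J$ satisfies the entropy condition (E1).
   Context: Flux: $f:[0,1]\to\mathbb R$ is a continuous, piecewise smooth, concave function with $f(0)=f(1)=0$, and there is a unique $\sigma\in\,]0,1[$ such that $f$ is strictly increasing on $[0,\sigma[$ and strictly decreasing on $]\sigma,1]$. Let $\tau:[0,1]\to[0,1]$ be the map with $f(\tau(\rho))=f(\rho)$ for all $\rho\in[0,1]$ and $\tau(\rho)\neq\rho$ for all $\rho\ne\sigma$. Convention: $\mathrm{sgn}(0)=0$. Riemann solver: a Riemann solver at a node with $n$ incoming arcs (indices $1,\dots,n$) and $m$ outgoing arcs (indices $n+1,\dots,n+m$) is a function $\mathcal{RS}:[0,1]^{n+m}\to[0,1]^{n+m}$, $(\rho_{1,0},\dots,\rho_{n+m,0})\mapsto(\bar\rho_1,\dots,\bar\rho_{n+m})$, such that for every initial datum: (1) $\sum_{i=1}^n f(\bar\rho_i)=\sum_{j=n+1}^{n+m}f(\bar\rho_j)$; (2) for every $i\in\{1,\dots,n\}$ the classical Riemann problem for $\rho_t+f(\rho)_x=0$ with left state $\rho_{i,0}$ and right state $\bar\rho_i$ is solved with waves with negative speed; that is, $\bar\rho_i\in\Phi_i$, where $\Phi_i=\{\rho_{i,0}\}\cup\,]\tau(\rho_{i,0}),1]$ if $\rho_{i,0}\le\sigma$ and $\Phi_i=[\sigma,1]$ if $\rho_{i,0}\ge\sigma$;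 (3) for every $j\in\{n+1,\dots,n+m\}$ the classical Riemann problem with left state $\bar\rho_j$ and right state $\rho_{j,0}$ is solved with waves with positive speed; that is, $\bar\rho_j\in\Phi_j$, where $\Phi_j=[0,\sigma]$ if $\rho_{j,0}\le\sigma$ and $\Phi_j=\{\rho_{j,0}\}\cup[0,\tau(\rho_{j,0})[$ if $\rho_{j,0}\ge\sigma$. Entropy-flux function: $\mathcal F(\rho_1,\dots,\rho_{n+m},k)=\sum_{i=1}^n\mathrm{sgn}(\rho_i-k)(f(\rho_i)-f(k))-\sum_{j=n+1}^{n+m}\mathrm{sgn}(\rho_j-k)(f(\rho_j)-f(k))$. (E1): $\mathcal{RS}$ satisfies the entropy condition (E1) if for every initial datum $(\rho_{1,0},\dots,\rho_{n+m,0})\in[0,1]^{n+m}$ and every $k\in[0,1]$ one has $\mathcal F(\bar\rho_1,\dots,\bar\rho_{n+m},k)\ge 0$, where $(\bar\rho_1,\dots,\bar\rho_{n+m})=\mathcal{RS}(\rho_{1,0},\dots,\rho_{n+m,0})$. *)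

(* Defs.v *)
From HB Require Import structures.
From mathcomp Require Import all_boot all_order all_algebra.
From mathcomp Require Import all_classical all_reals all_analysis.

Set Implicit Arguments.
Unset Strict Implicit.
Unset Printing Implicit Defensive.

Import Order.TTheory GRing.Theory Num.Theory.
Import numFieldNormedType.Exports.
Local Open Scope classical_set_scope.
Local Open Scope ring_scope.

(* Functions on [0, 1] are total functions on R of which only the values on
   [0, 1] matter: every condition below is restricted to [0, 1]. *)

(* C^oo on ]0, 1[ off a finite set of breakpoints.  Derivability of each iterated
   derivative is tested at interior points only, so it does not see the values
   of f outside [0, 1]. *)
Definition piecewise_smooth01 (R : realType) (f : R -> R) : Prop :=
  exists s : seq R, forall x : R, x \in `]0, 1[ -> x \notin s ->
    forall k : nat, derivable f^`(k)%classic x 1.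

Definition peak01 (R : realType) (f : R -> R) (sigma : R) : Prop :=
  [/\ sigma \in `]0, 1[,
      {in `[0, sigma[ &, {homo f : x y / x < y}} &
      {in `]sigma, 1] &, {homo f : x y / x < y >-> y < x}}].

Record is_flux (R : realType) (f : R -> R) (sigma : R) : Prop := IsFlux {
  flux_continuous : {within `[0, 1], continuous f};
  flux_piecewise_smooth : piecewise_smooth01 f;
  flux_concave : @convex_function R R^o `[0, 1] (fun x : R => - f x);
  flux0 : f 0 = 0;
  flux1 : f 1 = 0;
  flux_peak : unique (peak01 f) sigma
}.

Definition is_tau (R : realType) (f : R -> R) (sigma : R) (tau : R -> R)
    : Prop :=
  forall rho : R, rho \in `[0, 1] ->
    [/\ tau rho \in `[0, 1],
        f (tau rho) = f rho &
        rho != sigma -> tau rho != rho].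

(* At rho0 = sigma both clauses of each admissible set agree, since
   tau sigma = sigma; hence the case distinction on rho0 <= sigma. *)
Definition Phi_in (R : realType) (sigma : R) (tau : R -> R) (rho0 : R) : set R :=
  if rho0 <= sigma then [set rho0] `|` `]tau rho0, 1]%classic
  else `[sigma, 1]%classic.

Definition Phi_out (R : realType) (sigma : R) (tau : R -> R) (rho0 : R) : set R :=
  if rho0 <= sigma then `[0, sigma]%classic
  else [set rho0] `|` `[0, tau rho0[%classic.

Definition cube01 (R : realType) (N : nat) : set 'rV[R]_N :=
  [set rho | forall l, rho ord0 l \in `[0, 1]].

(* Coordinates lshift m i are the incoming arcs, rshift n j the outgoing ones;
   RS is a map of the cube, its values outside the cube being irrelevant. *)
Definition riemann_solver (R : realType) (n m : nat) (f : R -> R) (sigma : R)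
    (tau : R -> R) (RS : 'rV[R]_(n + m) -> 'rV[R]_(n + m)) : Prop :=
  forall rho0 : 'rV[R]_(n + m), cube01 rho0 ->
    let rho := RS rho0 in
    [/\ cube01 rho,
        \sum_(i < n) f (rho ord0 (lshift m i)) =
          \sum_(j < m) f (rho ord0 (rshift n j)),
        forall i : 'I_n,
          Phi_in sigma tau (rho0 ord0 (lshift m i)) (rho ord0 (lshift m i)) &
        forall j : 'I_m,
          Phi_out sigma tau (rho0 ord0 (rshift n j)) (rho ord0 (rshift n j))].

Definition entropy_flux (R : realType) (n m : nat) (f : R -> R)
    (rho : 'rV[R]_(n + m)) (k : R) : R :=
  \sum_(i < n) Num.sg (rho ord0 (lshift m i) - k)
                 * (f (rho ord0 (lshift m i)) - f k)
  - \sum_(j < m) Num.sg (rho ord0 (rshift n j) - k)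
                 * (f (rho ord0 (rshift n j)) - f k).

Definition entropy_E1 (R : realType) (n m : nat) (f : R -> R)
    (RS : 'rV[R]_(n + m) -> 'rV[R]_(n + m)) : Prop :=
  forall rho0 : 'rV[R]_(n + m), cube01 rho0 ->
    forall k : R, k \in `[0, 1] -> 0 <= entropy_flux f (RS rho0) k.

(* Main.v *)
Require Import Defs.
From mathcomp Require Import all_boot all_order all_algebra.
From mathcomp Require Import all_classical all_reals all_analysis.
From mathcomp Require Import ring lra.

(** A state equal to the same constant [c] on all arcs, with [f c = 0], has
entropy flux [sgn(c - k) (m - n) f(k)].  For [k] in ]0, 1[ this has the sign of
[m - n] if [c = 1], and of [n - m] if [c = 0].  Hence (E1) fails at the jammed
state 1 when [n > m] and at the empty state 0 when [n < m], and it remains to see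
that every Riemann solver fixes these two states ([riemann_solver_jammed],
[riemann_solver_empty]).

Extremal data leave no freedom on one side of the node: as [tau] exchanges 0 and
1, a jammed outgoing arc can only stay jammed and an empty incoming arc can only
stay empty.  No flux then passes through that side, nor, by conservation, through
the other one.  Since [f] is positive on ]0, 1[ ([flux_gt0]), every trace on the
other side is 0 or 1, and the admissible sets keep it on the same side of [sigma]
as its datum. *)

Import Order.TTheory GRing.Theory Num.Theory.

Set Implicit Arguments.
Unset Strict Implicit.
Unset Printing Implicit Defensive.

Local Open Scope ring_scope.

(** Near 0 this is monotonicity.  Any other [x] lies between such a point [y] and
1, where [f] vanishes, so concavity bounds [f x] from below by a positive
multiple of [f y]. *)
Lemma flux_gt0 (R : realType) (f : R -> R) (sigma x : R) :
  is_flux f sigma -> 0 < x < 1 -> 0 < f x.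
Proof.
case=> _ _ fconc f0 f1 [[s01 fincr _] _] /andP[x0 x1].
have /andP[s0 s1] : 0 < sigma < 1 by move: s01; rewrite in_itv.
(* The product is a uniform choice of a point below both sigma and x. *)
pose y := x * sigma.
have y0 : 0 < y by rewrite mulr_gt0.
have yx : y < x by rewrite /y gtr_pMr.
have ys : y < sigma by rewrite /y gtr_pMl.
have fy : 0 < f y.
  by rewrite -f0; apply: fincr; rewrite // in_itv /= ?lexx ?s0 // (ltW y0).
have y1 : 0 < 1 - y by lra.
pose t := (1 - x) / (1 - y).
have t0 : 0 < t by rewrite divr_gt0// subr_gt0.
have t1 : t <= 1 by rewrite ler_pdivrMr//; lra.
have y01 : y \in `[0, 1]%classic.
  by apply/mem_set; rewrite /= in_itv /=; apply/andP; lra.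
have one01 : (1 : R) \in `[0, 1]%classic.
  by apply/mem_set; rewrite /= in_itv /= lexx ler01.
have : - f (t * y + (1 - t) * 1) <= t * - f y + (1 - t) * - f 1.
  exact: (fconc (Itv01 (ltW t0) t1) y 1 y01 one01).
have -> : t * y + (1 - t) * 1 = x by rewrite /t; field; rewrite gt_eqF.
rewrite f1 oppr0 mulr0 addr0 mulrN lerN2.
by apply: lt_le_trans; rewrite mulr_gt0.
Qed.

Lemma flux_ge0 (R : realType) (f : R -> R) (sigma x : R) :
  is_flux f sigma -> x \in `[0, 1] -> 0 <= f x.
Proof.
move=> fP; rewrite in_itv /= !le_eqVlt => /andP[/predU1P[<- _|x0]].
  by rewrite (flux0 fP) eqxx.
case/predU1P=> [->|x1]; first by rewrite (flux1 fP) eqxx.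
by rewrite (flux_gt0 fP) ?x0 ?orbT.
Qed.

Lemma flux_eq0 (R : realType) (f : R -> R) (sigma x : R) :
  is_flux f sigma -> x \in `[0, 1] -> f x = 0 -> x = 0 \/ x = 1.
Proof.
move=> fP; rewrite in_itv /= !le_eqVlt => /andP[/predU1P[<-|x0]]; first by left.
case/predU1P=> [->|x1] fx0; first by right.
by have := @flux_gt0 _ _ _ x fP; rewrite fx0 ltxx x0 x1 => /(_ isT).
Qed.

Lemma sigma_gt0_lt1 (R : realType) (f : R -> R) (sigma : R) :
  is_flux f sigma -> 0 < sigma < 1.
Proof. by case=> _ _ _ _ _ [[]]; rewrite in_itv. Qed.

Lemma tau0 (R : realType) (f tau : R -> R) (sigma : R) :
  is_flux f sigma -> is_tau f sigma tau -> tau 0 = 1.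
Proof.
move=> fP tauP; have /andP[s0 _] := sigma_gt0_lt1 fP.
have [|t01 ft /(_ _)] := tauP 0; first by rewrite in_itv /= lexx ler01.
rewrite lt_eqF// => /(_ isT).
by case: (flux_eq0 fP t01); rewrite ?ft ?(flux0 fP)// => ->; rewrite eqxx.
Qed.

Lemma tau1 (R : realType) (f tau : R -> R) (sigma : R) :
  is_flux f sigma -> is_tau f sigma tau -> tau 1 = 0.
Proof.
move=> fP tauP; have /andP[_ s1] := sigma_gt0_lt1 fP.
have [|t01 ft /(_ _)] := tauP 1; first by rewrite in_itv /= lexx ler01.
rewrite gt_eqF// => /(_ isT).
by case: (flux_eq0 fP t01); rewrite ?ft ?(flux1 fP)// => ->; rewrite eqxx.
Qed.

Lemma cube01_const (R : realType) (N : nat) (c : R) :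
  c \in `[0, 1] -> @cube01 R N (const_mx c).
Proof. by move=> c01 l; rewrite mxE. Qed.

(** The outgoing datum 1 admits only 1, because [`[0, tau 1[] is empty; the flux
is thus 0 everywhere, and an incoming datum above [sigma] excludes the other zero
of [f], namely 0. *)
Lemma riemann_solver_jammed (R : realType) (n m : nat) (f tau : R -> R)
    (sigma : R) (RS : 'rV[R]_(n + m) -> 'rV[R]_(n + m)) :
  is_flux f sigma -> is_tau f sigma tau -> riemann_solver f sigma tau RS ->
  RS (const_mx 1) = const_mx 1.
Proof.
move=> fP tauP RSP; have /andP[s0 s1] := sigma_gt0_lt1 fP.
have [|rho01 flux_eq inP outP] := RSP (const_mx 1).
  by apply: cube01_const; rewrite in_itv /= lexx ler01.
set rho := RS _ in rho01 flux_eq inP outP *.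
have out1 j : rho ord0 (rshift n j) = 1.
  have := outP j; rewrite mxE /Phi_out leNgt s1 /= (tau1 fP tauP).
  by case=> //=; rewrite in_itv /= => /andP[/le_lt_trans/[apply]]; rewrite ltxx.
have sum0 : \sum_(i < n) f (rho ord0 (lshift m i)) = 0.
  by rewrite flux_eq big1// => j _; rewrite out1 (flux1 fP).
have in1 i : rho ord0 (lshift m i) = 1.
  have fi : f (rho ord0 (lshift m i)) = 0.
    exact: (psumr_eq0P (fun i _ => flux_ge0 fP (rho01 _)) sum0).
  have [r0|//] := flux_eq0 fP (rho01 _) fi.
  by have := inP i; rewrite mxE /Phi_in leNgt s1 /= r0 in_itv /= leNgt s0.
by apply/rowP => l; rewrite mxE; case: (split_ordP l) => j ->.
Qed.

(** The mirror image: the forced side is now the incoming one, because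
[`]tau 0, 1]] is empty. *)
Lemma riemann_solver_empty (R : realType) (n m : nat) (f tau : R -> R)
    (sigma : R) (RS : 'rV[R]_(n + m) -> 'rV[R]_(n + m)) :
  is_flux f sigma -> is_tau f sigma tau -> riemann_solver f sigma tau RS ->
  RS (const_mx 0) = const_mx 0.
Proof.
move=> fP tauP RSP; have /andP[s0 s1] := sigma_gt0_lt1 fP.
have [|rho01 flux_eq inP outP] := RSP (const_mx 0).
  by apply: cube01_const; rewrite in_itv /= lexx ler01.
set rho := RS _ in rho01 flux_eq inP outP *.
have in0 i : rho ord0 (lshift m i) = 0.
  have := inP i; rewrite mxE /Phi_in (ltW s0) (tau0 fP tauP).
  by case=> //=; rewrite in_itv /= => /andP[/lt_le_trans/[apply]]; rewrite ltxx.
have sum0 : \sum_(j < m) f (rho ord0 (rshift n j)) = 0.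
  by rewrite -flux_eq big1// => i _; rewrite in0 (flux0 fP).
have out0 j : rho ord0 (rshift n j) = 0.
  have fj : f (rho ord0 (rshift n j)) = 0.
    exact: (psumr_eq0P (fun j _ => flux_ge0 fP (rho01 _)) sum0).
  have [//|r1] := flux_eq0 fP (rho01 _) fj.
  by have := outP j; rewrite mxE /Phi_out (ltW s0) /= r1 in_itv /= (leNgt 1) s1 andbF.
by apply/rowP => l; rewrite mxE; case: (split_ordP l) => j ->.
Qed.

Lemma entropy_flux_const (R : realType) (n m : nat) (f : R -> R) (c k : R) :
  entropy_flux f (const_mx c : 'rV[R]_(n + m)) k =
  (n%:R - m%:R) * (Num.sg (c - k) * (f c - f k)).
Proof.
rewrite /entropy_flux.
under eq_bigr do rewrite mxE.
under [X in _ - X]eq_bigr do rewrite mxE.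
by rewrite !sumr_const !card_ord mulrBl !mulr_natl.
Qed.

Theorem theorem3p1 (R : realType) (n m : nat) (f : R -> R) (sigma : R)
    (tau : R -> R)
    (n_ge1 : (1 <= n)%N) (m_ge1 : (1 <= m)%N) (n_neq_m : n <> m)
    (f_flux : is_flux f sigma) (tauP : is_tau f sigma tau) :
  ~ exists RS : 'rV[R]_(n + m) -> 'rV[R]_(n + m),
      riemann_solver f sigma tau RS /\ entropy_E1 f RS.
Proof.
case=> RS [RSP E1]; have /andP[s0 s1] := sigma_gt0_lt1 f_flux.
have fs : 0 < f sigma by apply: (flux_gt0 f_flux); rewrite s0.
have s01 : sigma \in `[0, 1] by rewrite in_itv /= !ltW.
have [nm|mn|//] := ltngtP n m.
- have c01 : @cube01 R (n + m) (const_mx 0).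
    by apply: cube01_const; rewrite in_itv /= lexx ler01.
  have := E1 _ c01 _ s01.
  rewrite (riemann_solver_empty f_flux tauP RSP) entropy_flux_const.
  rewrite (flux0 f_flux) ltr0_sg ?subr_lt0// sub0r mulrNN mul1r.
  by rewrite pmulr_lge0// subr_ge0 ler_nat leqNgt nm.
- have c01 : @cube01 R (n + m) (const_mx 1).
    by apply: cube01_const; rewrite in_itv /= lexx ler01.
  have := E1 _ c01 _ s01.
  rewrite (riemann_solver_jammed f_flux tauP RSP) entropy_flux_const.
  rewrite (flux1 f_flux) gtr0_sg ?subr_gt0// sub0r mul1r.
  by rewrite nmulr_lge0 ?oppr_lt0// subr_le0 ler_nat leqNgt mn.
Qed.
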